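(* Let $n,r,k$ be integers with $0\le r\le\lfloor n/2\rfloor-1$ and $0\le k\le r$, and let $M_0$ be a real $n\times n$ skew-symmetric matrix of rank $2k$. Up to the isometric action $M\mapsto PMP^T$ of $P\in SO(n)$ one may take $M_0=\sum_{i=1}^k x_iX_{2i-1,2i}$ with $x_1\ge\cdots\ge x_k>0$. For $M_0$ of this form, let $V$ be a real $n\times n$ skew-symmetric matrix with block form $$V=\begin{pmatrix}A&B\\-B^T&D\end{pmatrix},$$ where $A$ is $2k\times 2k$. Then $$V\in \operatorname{Tan}(\mathbf{C}(n,2r),M_0)\iff \operatorname{rank}D\le 2r-2k.$$ Consequently, for $M_0$ of rank $2k$, $\operatorname{Tan}(\mathbf{C}(n,2r),M_0)$ is isometric to $\mathbf{C}(n-2k,2r-2k)\times\mathbf{R}^{k(2n-2k-1)}$.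
   Context: $Skew(n,\mathbf{R})$ is the space of real $n\times n$ skew-symmetric matrices with norm $|M|^2=\frac12\operatorname{tr}(MM^T)$. The Pfaffian variety is $\mathbf{C}(n,2r)=\{X\in Skew(n,\mathbf{R}):\operatorname{rank}X\le 2r\}$ (so $\mathbf{C}(n,0)=\{0\}$). For $i<j$, $X_{ij}$ is the $n\times n$ skew-symmetric matrix with $1$ in position $(i,j)$, $-1$ in position $(j,i)$ and zeros elsewhere. For a normed vector space $X$, a subset $S\subset X$ and a point $a\in X$, the tangent cone is $$\operatorname{Tan}(S,a)=\{v\in X:\ \forall\varepsilon>0\ \exists x\in S,\ \exists \rho>0\ \text{with } |x-a|<\varepsilon,\ |\rho(x-a)-v|<\varepsilon\}.$$ *)

(* Defs.v *)
From HB Require Import structures.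
From mathcomp Require Import all_boot all_order all_algebra.
From mathcomp Require Import all_classical all_reals.
From mathcomp Require Import topology normedtype.
From mathcomp Require Import zify lra.

Set Implicit Arguments.
Unset Strict Implicit.
Unset Printing Implicit Defensive.
Import Order.TTheory GRing.Theory Num.Theory.
Import numFieldNormedType.Exports.
Local Open Scope classical_set_scope.
Local Open Scope ring_scope.

Section L2norm.
Variables (R : realType) (I : finType).
Implicit Types f g : I -> R.

Definition l2norm f : R := Num.sqrt (\sum_i f i ^+ 2).

Lemma sumsq_ge0 f : 0 <= \sum_i f i ^+ 2.
Proof. by apply: sumr_ge0 => i _; exact: sqr_ge0. Qed.

Lemma CauchySchwarz_sum f g :
  (\sum_i f i * g i) ^+ 2 <= (\sum_i f i ^+ 2) * (\sum_i g i ^+ 2).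
Proof.
set a := \sum_i f i ^+ 2; set b := \sum_i f i * g i; set c := \sum_i g i ^+ 2.
have E s t : s ^+ 2 * a + 2 * s * t * b + t ^+ 2 * c =
             \sum_i (s * f i + t * g i) ^+ 2.
  rewrite /a /b /c !mulr_sumr -!big_split /=.
  by apply: eq_bigr => i _; lra.
have P s t : 0 <= s ^+ 2 * a + 2 * s * t * b + t ^+ 2 * c.
  by rewrite E; exact: sumsq_ge0.
have a0 : 0 <= a by exact: sumsq_ge0.
have [a_eq0|a_neq0] := eqVneq a 0.
  have f0 i : f i = 0.
    apply/eqP; rewrite -sqrf_eq0; apply/eqP.
    by move/psumr_eq0P: a_eq0 => -> // j _; exact: sqr_ge0.
  have -> : b = 0 by rewrite /b big1 // => i _; rewrite f0 mul0r.
  by rewrite a_eq0 mul0r expr0n.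
have a_gt0 : 0 < a by rewrite lt_neqAle eq_sym a_neq0.
rewrite -subr_ge0 -(pmulr_rge0 _ a_gt0).
suff -> : a * (a * c - b ^+ 2) =
  (- b) ^+ 2 * a + 2 * (- b) * a * b + a ^+ 2 * c by exact: P.
by lra.
Qed.

Lemma l2norm_triangle f g : l2norm (fun i => f i + g i) <= l2norm f + l2norm g.
Proof.
have fg0 : 0 <= l2norm f + l2norm g by rewrite addr_ge0 ?sqrtr_ge0.
rewrite -(ler_pXn2r (n := 2)) ?nnegrE ?sqrtr_ge0 // sqr_sqrtr ?sumsq_ge0 //.
have -> : \sum_i (f i + g i) ^+ 2 =
    \sum_i f i ^+ 2 + 2 * (\sum_i f i * g i) + \sum_i g i ^+ 2.
  by rewrite mulr_sumr -!big_split /=; apply: eq_bigr => i _; lra.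
have b_le : \sum_i f i * g i <= l2norm f * l2norm g.
  rewrite /l2norm -sqrtrM ?sumsq_ge0 //.
  apply: (le_trans (ler_norm _)); rewrite -sqrtr_sqr.
  by apply: ler_wsqrtr; exact: CauchySchwarz_sum.
by rewrite sqrrD !sqr_sqrtr ?sumsq_ge0 //; lra.
Qed.

Lemma l2normZ a f : l2norm (fun i => a * f i) = `|a| * l2norm f.
Proof.
rewrite /l2norm.
under eq_bigr do rewrite exprMn.
by rewrite -mulr_sumr sqrtrM ?sqr_ge0 // sqrtr_sqr.
Qed.

Lemma l2norm_eq0 f : l2norm f = 0 -> forall i, f i = 0.
Proof.
move/eqP; rewrite sqrtr_eq0 => h i.
have /psumr_eq0P h0 : \sum_i f i ^+ 2 = 0.
  by apply/eqP; rewrite eq_le h sumsq_ge0.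
by apply/eqP; rewrite -sqrf_eq0 h0 // => j _; exact: sqr_ge0.
Qed.

End L2norm.

Section TangentCone.
Variables (R : realType) (X : normedModType R).

Definition Tan (S : set X) (a : X) : set X :=
  [set v | forall e : R, 0 < e ->
    exists x : X, exists rho : R,
      [/\ S x, 0 < rho, `|x - a| < e & `|rho *: (x - a) - v| < e]].

End TangentCone.

(* Two subsets of metric spaces (given by their distances) are isometric. *)
Definition isometric (R : realType) (X Y : Type)
    (dX : X -> X -> R) (A : set X) (dY : Y -> Y -> R) (B : set Y) : Prop :=
  exists f : X -> Y, set_bij A B f /\
    forall x y, A x -> A y -> dY (f x) (f y) = dX x y.

Section Skew.
Variables (R : realType) (n : nat).

Definition is_skew : {pred 'M[R]_n} := fun M => M^T == - M.

Fact is_skew_submod_closed : submod_closed is_skew.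
Proof.
split=> [|a M N]; rewrite ?unfold_in /is_skew; first by rewrite trmx0 oppr0.
by move=> /eqP hM /eqP hN; rewrite linearP /= hM hN scalerN opprD.
Qed.

HB.instance Definition _ :=
  GRing.isSubmodClosed.Build R 'M[R]_n is_skew is_skew_submod_closed.

Record skewmx := Skewmx { mx_of_skew :> 'M[R]_n; _ : mx_of_skew \in is_skew }.

HB.instance Definition _ := [isSub for mx_of_skew].
HB.instance Definition _ := [Choice of skewmx by <:].
HB.instance Definition _ := [SubChoice_isSubLmodule of skewmx by <:].

Lemma tr_skewmx (M : skewmx) : M^T = - (M : 'M[R]_n).
Proof. by apply/eqP; case: M. Qed.

Definition skew_norm (M : skewmx) : R :=
  Num.sqrt (2^-1 * \tr ((M : 'M[R]_n) *m M^T)).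

Lemma skew_normE (M : skewmx) :
  skew_norm M = Num.sqrt 2^-1 * l2norm (fun p : 'I_n * 'I_n => M p.1 p.2).
Proof.
rewrite /skew_norm /l2norm sqrtrM ?invr_ge0 //; congr (_ * Num.sqrt _).
rewrite -(pair_bigA _ (fun i j => (M : 'M[R]_n) i j ^+ 2)) /=.
by apply: eq_bigr => i _; rewrite mxE; apply: eq_bigr => j _; rewrite mxE expr2.
Qed.

Fact skew_normD M N : skew_norm (M + N) <= skew_norm M + skew_norm N.
Proof.
rewrite !skew_normE -mulrDr ler_wpM2l ?sqrtr_ge0 //.
apply: le_trans (l2norm_triangle _ _).
by rewrite le_eqVlt; apply/orP; left; apply/eqP; congr l2norm;
  apply/funext => p; rewrite mxE.
Qed.

Fact skew_normZ (a : R) M : skew_norm (a *: M) = `|a| * skew_norm M.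
Proof.
rewrite !skew_normE mulrCA -l2normZ; congr (_ * l2norm _).
by apply/funext => p; rewrite mxE.
Qed.

Fact skew_norm0_eq0 M : skew_norm M = 0 -> M = 0.
Proof.
rewrite skew_normE => /eqP; rewrite mulf_eq0 sqrtr_eq0 leNgt invr_gt0 ltr0n /=.
move/eqP/l2norm_eq0 => h; apply/val_inj/matrixP => i j.
by rewrite (h (i, j)) mxE.
Qed.

(* Norm and topology of skewmx come from skew_norm, not from the sup norm that
   the library puts on 'M[R]_n. *)
HB.instance Definition _ :=
  Lmodule_isNormed.Build R skewmx skew_normD skew_normZ skew_norm0_eq0.

Lemma norm_skewmxE (M : skewmx) : `|M| = skew_norm M.
Proof. by []. Qed.

(* C(n, 2r) is pfaffian_variety (2 * r). *)
Definition pfaffian_variety (s : nat) : set skewmx :=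
  [set X : skewmx | (\rank (X : 'M[R]_n) <= s)%N].

(* Indices count from 0: the X_{i,j} of the usual 1-based notation is
   skew_elem i.-1 j.-1. *)
Definition skew_elem_mx (a b : nat) : 'M[R]_n :=
  \matrix_(i, j) (((i == a :> nat) && (j == b :> nat))%:R
                  - ((i == b :> nat) && (j == a :> nat))%:R).

Fact skew_elem_subproof a b : skew_elem_mx a b \in is_skew.
Proof.
rewrite unfold_in; apply/eqP/matrixP => i j; rewrite !mxE opprB.
by rewrite andbC [(j == b :> nat) && _]andbC.
Qed.

Definition skew_elem (a b : nat) : skewmx := Skewmx (skew_elem_subproof a b).

Definition skew_normal_form (k : nat) (x : 'I_k -> R) : skewmx :=
  \sum_(i < k) x i *: skew_elem (2 * i) (2 * i).+1.

Definition SO : set 'M[R]_n := [set P | P *m P^T = 1%:M /\ \det P = 1].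

Fact skew_conj_subproof (P : 'M[R]_n) (M : skewmx) : P *m M *m P^T \in is_skew.
Proof.
by rewrite unfold_in !trmx_mul trmxK tr_skewmx mulNmx mulmxN mulmxA.
Qed.

Definition skew_conj (P : 'M[R]_n) (M : skewmx) : skewmx :=
  Skewmx (skew_conj_subproof P M).

End Skew.

Arguments pfaffian_variety {R} n s.
Arguments SO {R} n.
Arguments skew_normal_form {R} n {k} x.

Notation "''Skew[' R ]_ n" := (skewmx R n)
  (at level 8, n at level 2, format "''Skew[' R ]_ n") : type_scope.

Definition prod_dist (R : realType) (m d : nat)
    (p q : 'Skew[R]_m * 'rV[R]_d) : R :=
  Num.sqrt (`|p.1 - q.1| ^+ 2 + l2norm (fun i => p.2 0 i - q.2 0 i) ^+ 2).

Lemma block_dim n r k : (r < n./2)%N -> (k <= r)%N ->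
  (2 * k + (n - 2 * k) = n)%N.
Proof. by lia. Qed.

(* Main.v *)
(* For M0 = [A0 0; 0 0] with A0 invertible and V = [A B; -B^T D]:
   - if rank D > 2r - 2k, pick L, Q with L D Q = 1 of size 2r - 2k + 1.  For x
     near M0 in C(n, 2r) with rho (x - M0) near V, the singular matrix
     diag(1, rho L) x diag(1, Q) is close to [A0 0; * 1], whose determinant is
     nonzero;
   - if rank D <= 2r - 2k, put N_t = diag(A0 + tA, tD) and
     K = [0 0; -B^T A0^-1 0].  The curve (1 + tK) N_t (1 + tK)^T stays in
     C(n, 2r) and leaves M0 with velocity V.
   The normal form comes from maximising |uM| over unit vectors u: a maximiser u
   and v = uM / |uM| span an invariant plane, which is split off.  As the rank
     is
   less than n, flipping one kernel vector of the normal form corrects the sign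
   of the determinant.
   The isometry conjugates M0 to normal form and records D together with the
   entries (i, j) of V above the diagonal that lie in A or B: |V|^2 is the sum
     of
   the squares of all entries above the diagonal. *)

Require Import Defs.
From HB Require Import structures.
From mathcomp Require Import all_boot all_order all_algebra.
From mathcomp Require Import all_classical all_reals.
From mathcomp Require Import topology normedtype derive.
From mathcomp Require Import zify ring lra.

Set Implicit Arguments.
Unset Strict Implicit.
Unset Printing Implicit Defensive.
Import Order.TTheory GRing.Theory Num.Theory.
Import numFieldNormedType.Exports.
Local Open Scope classical_set_scope.
Local Open Scope ring_scope.

(** * Entrywise limits of determinants and matrix products *)

Lemma cvg_det (R : realType) (T : Type) (F : set_system T) (FF : Filter F) n
    (f : T -> 'M[R]_n) (A : 'M[R]_n) :
  (forall i j, f x i j @[x --> F] --> A i j) ->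
  \det (f x) @[x --> F] --> \det A.
Proof.
move=> fA; rewrite /determinant; apply: cvg_big => [|s _].
  exact: add_continuous.
apply: cvgM; first exact: cvg_cst.
by apply: cvg_big => [|i _]; [exact: mul_continuous | exact: fA].
Qed.

Lemma cvg_mulmx (R : realType) (T : Type) (F : set_system T) (FF : Filter F)
    m n p q (P : 'M[R]_(m, n)) (Q : 'M[R]_(p, q)) (f : T -> 'M[R]_(n, p)) (A :
      'M[R]_(n, p)) :
  (forall i j, f x i j @[x --> F] --> A i j) ->
  forall i j, (P *m f x *m Q) i j @[x --> F] --> (P *m A *m Q) i j.
Proof.
move=> fA i j; rewrite mxE; under eq_cvg do rewrite mxE.
apply: cvg_big => [|l _]; first exact: add_continuous.
apply: cvgM; last exact: cvg_cst.
rewrite mxE; under eq_cvg do rewrite mxE.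
apply: cvg_big => [|h _]; first exact: add_continuous.
by apply: cvgM; [exact: cvg_cst | exact: fA].
Qed.

(** * The norm of ['Skew[R]_n] in terms of matrix entries *)

Section SkewNorm.
Variables (R : realType) (n : nat).
Implicit Types M N : 'Skew[R]_n.

Lemma mx_of_skew_inj : injective (@mx_of_skew R n).
Proof. exact: val_inj. Qed.

Lemma skewmxB M N : mx_of_skew (M - N) = mx_of_skew M - mx_of_skew N.
Proof. by []. Qed.

Lemma skewmxZ c M : mx_of_skew (c *: M) = c *: mx_of_skew M.
Proof. by []. Qed.

Lemma skewmxD M N : mx_of_skew (M + N) = mx_of_skew M + mx_of_skew N.
Proof. by []. Qed.

Lemma sqr_norm_skewmx M :
  `|M| ^+ 2 = 2^-1 * \sum_i \sum_j (M : 'M[R]_n) i j ^+ 2.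
Proof.
rewrite norm_skewmxE skew_normE exprMn !sqr_sqrtr ?sumsq_ge0 ?invr_ge0 //.
by rewrite (pair_bigA _ (fun i j => (M : 'M[R]_n) i j ^+ 2)).
Qed.

(** The crude constant 2 absorbs the factor 1/2 in the squared norm without introducing a square
    root; only continuity of the entries is wanted from it. *)
Lemma ler_coord_skewmx M i j : `|(M : 'M[R]_n) i j| <= 2 * `|M|.
Proof.
rewrite -ler_sqr ?nnegrE ?mulr_ge0 // exprMn sqr_norm_skewmx real_normK
  ?num_real //.
rewrite (bigD1 i) //= (bigD1 j) //=.
have h1 : 0 <= \sum_(l | l != j) (M : 'M[R]_n) i l ^+ 2.
  by apply: sumr_ge0 => *; exact: sqr_ge0.
have h2 : 0 <= \sum_(h | h != i) \sum_l (M : 'M[R]_n) h l ^+ 2.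
  by apply: sumr_ge0 => *; apply: sumr_ge0 => *; exact: sqr_ge0.
have h3 := sqr_ge0 ((M : 'M[R]_n) i j).
by lra.
Qed.

Lemma coord_skewmx_continuous i j :
  continuous (fun M : 'Skew[R]_n => (M : 'M[R]_n) i j).
Proof.
move=> M; have FM : Filter (nbhs M) := nbhs_filter M.
apply/(@cvgrPdist_lt _ _ _ _ FM) => e e0; apply/nbhs_ballP.
exists (e / 2) => [|N] /=; first by rewrite divr_gt0.
rewrite -ball_normE /= ltr_pdivlMr // mulrC => MN.
have -> : (M : 'M[R]_n) i j - (N : 'M[R]_n) i j = ((M - N : 'Skew[R]_n) :
  'M[R]_n) i j.
  by rewrite !mxE.
exact: le_lt_trans (ler_coord_skewmx _ _ _) MN.
Qed.

End SkewNorm.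

(** Gaussian elimination writes [D] as an invertible matrix, times a partial identity, times an
    invertible matrix. Undoing the outer factors and truncating to size [t] leaves the identity. *)
Lemma mxrank_factor1 (F : fieldType) m n t (D : 'M[F]_(m, n)) :
  (t <= \rank D)%N ->
  exists (L : 'M[F]_(t, m)) (Q : 'M[F]_(n, t)), L *m D *m Q = 1%:M.
Proof.
move=> tD.
exists (pid_mx t *m invmx (col_ebase D)), (invmx (row_ebase D) *m pid_mx t).
rewrite -{2}(mulmx_ebase D) !mulmxA mulmxKV ?col_ebase_unit //.
rewrite mulmxK ?row_ebase_unit // !mul_pid_mx -pid_mx_1.
by congr pid_mx; have := rank_leq_row D; have := rank_leq_col D; lia.
Qed.

(** * The rank criterion for tangency at a block matrix *)

Section BlockTangent.
Variables (R : realType) (a m s : nat).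
Variables (A0 A : 'M[R]_a) (B : 'M[R]_(a, m)) (D : 'M[R]_m).
Variables M0 V : 'Skew[R]_(a + m).
Hypothesis A0_unit : A0 \in unitmx.
Hypothesis M0E : (M0 : 'M[R]_(a + m)) = block_mx A0 0 0 0.
Hypothesis VE : (V : 'M[R]_(a + m)) = block_mx A B (- B^T) D.

Lemma Tan_rank_drsubmx : Tan (pfaffian_variety (a + m) s) M0 V ->
  (\rank D <= s - a)%N.
Proof.
move=> tanV; rewrite leqNgt; apply/negP => /mxrank_factor1[L [Q LDQ]].
set t := (s - a).+1 in L Q LDQ.
pose P1 : 'M[R]_(a + t, a + m) := block_mx 1%:M 0 0 0.
pose P2 : 'M[R]_(a + t, a + m) := block_mx 0 0 0 L.
pose Q' : 'M[R]_(a + m, a + t) := block_mx 1%:M 0 0 Q.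
(* [S X Y] takes its first [a] rows from [X] and its last [t] rows from [Y]. At [(M0, V)] it is
   block lower triangular with diagonal blocks [A0] and [L *m D *m Q = 1]. *)
pose S (X Y : 'M[R]_(a + m)) := P1 *m X *m Q' + P2 *m Y *m Q'.
have SE : \det (S M0 V) != 0.
  rewrite /S M0E VE !mulmx_block !(mul0mx, mulmx0, mul1mx, mulmx1, addr0,
    add0r).
  rewrite add_block_mx !(addr0, add0r) LDQ det_lblock det1 mulr1.
  by rewrite -unitfE -unitmxE.
have FMV : Filter (nbhs (M0, V)) := nbhs_filter (M0, V).
have : (fun z : 'Skew[R]_(a + m) * 'Skew[R]_(a + m) => \det (S z.1 z.2))
    @ nbhs (M0, V) --> \det (S M0 V).
  apply: cvg_det => i j; rewrite /S mxE; under eq_cvg do rewrite mxE.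
  apply: cvgD; apply: cvg_mulmx => {}i {}j.
    exact: (cvg_comp _ (fun N : 'Skew[R]_(a + m) => (N : 'M[R]_(a + m)) i j)
      cvg_fst (@coord_skewmx_continuous _ _ i j M0)).
  exact: (cvg_comp _ (fun N : 'Skew[R]_(a + m) => (N : 'M[R]_(a + m)) i j)
    cvg_snd (@coord_skewmx_continuous _ _ i j V)).
move=> /(@cvgr_neq0 _ _ _ _ FMV) /(_ SE) /nbhs_ballP[e e0 Se].
 have [x [rho [xS rho0 xM0 xV]]] := tanV e e0.
have /negP[] : \det (S x (rho *: (x - M0))) != 0.
  apply: (Se (_, _)); split; rewrite -ball_normE /=; first by rewrite distrC.
  by rewrite distrC.
(* The last [m] rows of [M0] vanish, so [P2] kills [M0] and both summands become multiples of the
   same [x]. *)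
have -> : S x (rho *: (x - M0)) = (P1 + rho *: P2) *m x *m Q'.
  rewrite /S skewmxZ skewmxB !mulmxDl; congr (_ + _); rewrite -scalemxAl
    -scalemxAr -!scalemxAl.
  congr (_ *: (_ *m _)).
  rewrite mulmxBr M0E [X in _ - X]mulmx_block.
  by rewrite !(mul0mx, mulmx0, addr0) block_mx0 subr0.
(* [W] has size [a + t], which exceeds [s], while its rank is at most that of [x]; hence it is
   singular. *)
set W := _ *m _ *m _; apply/negPn; rewrite -unitfE -unitmxE -row_free_unit.
rewrite /row_free neq_ltn; apply/orP; left.
apply: leq_ltn_trans (mxrankM_maxl _ _) _.
apply: leq_ltn_trans (mxrankM_maxr _ _) _.
by apply: leq_ltn_trans xS _; rewrite /t; lia.
Qed.

Lemma rank_drsubmx_Tan : (a <= s)%N -> (\rank D <= s - a)%N ->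
  Tan (pfaffian_variety (a + m) s) M0 V.
Proof.
move=> as_ rD.
have /eqP := tr_skewmx V; rewrite VE tr_block_mx opp_block_mx => /eqP.
case/eq_block_mx => trA _ _ trD.
have /eqP := tr_skewmx M0; rewrite M0E tr_block_mx opp_block_mx => /eqP.
case/eq_block_mx => trA0 _ _ _.
have E_skew : block_mx A 0 0 D \in @Defs.is_skew R (a + m).
  by rewrite unfold_in tr_block_mx trA trD !trmx0 opp_block_mx !oppr0.
pose E := Skewmx E_skew.
pose K : 'M[R]_(a + m) := block_mx 0 0 (- B^T *m invmx A0) 0.
have KE_skew : K *m E + E *m K^T \in @Defs.is_skew R (a + m).
  rewrite unfold_in raddfD /= !trmx_mul trmxK -/(mx_of_skew E) (tr_skewmx E).
  by rewrite mulmxN mulNmx opprD addrC.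
(* [W1] and [W2] are the coefficients of [t ^ 2] and [t ^ 3] in the curve [x t] below. *)
pose W1 := skew_conj K M0 + Skewmx KE_skew.
pose W2 := skew_conj K E.
(* The linear coefficient of the curve is [V]: [E] supplies [A] and [D], [K *m M0] supplies [- B^T],
   and [M0 *m K^T] supplies [B]. *)
have VEK : mx_of_skew V = mx_of_skew E + K *m M0 + M0 *m K^T.
  have KM0 : K *m M0 = block_mx 0 0 (- B^T) 0.
    by rewrite M0E mulmx_block !(mul0mx, mulmx0, addr0) mulmxKV.
  have -> : M0 *m K^T = - (K *m M0)^T by rewrite trmx_mul tr_skewmx mulNmx
    opprK.
  rewrite KM0 VE /= tr_block_mx linearN /= trmxK !trmx0 opp_block_mx opprK
    !oppr0.
  by rewrite !add_block_mx !(addr0, add0r).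
pose x t := skew_conj (1%:M + t *: K) (M0 + t *: E).
have xE t : x t - M0 = t *: (V + t *: (W1 + t *: W2)).
  apply: mx_of_skew_inj; rewrite !(skewmxB, skewmxD, skewmxZ) VEK /x /W1 /W2 /=.
  have -> : (1%:M + t *: K)^T = 1%:M + t *: K^T.
    by rewrite raddfD /= trmx1 linearZ.
  rewrite !(mulmxDl, mulmxDr) !mul1mx !mulmx1.
  rewrite -!(scalemxAl, scalemxAr).
  move: (block_mx A 0 0 D) => E'; set X1 := K *m mx_of_skew M0; set X2 := X1 *m
    _; set X3 := mx_of_skew M0 *m _.
  set X4 := K *m E'; set X5 := X4 *m _; set X6 := E' *m K^T.
  by apply/matrixP => i j; rewrite !mxE; lra.
(* Multiplying by [1 + t K] on both sides cannot raise the rank, and [M0 + t E] is block diagonal,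
   with rank at most [a + (s - a)]. *)
have xS t : pfaffian_variety (a + m) s (x t).
  apply: leq_trans (mxrankM_maxl _ _) _; apply: leq_trans (mxrankM_maxr _ _) _.
  rewrite skewmxD skewmxZ M0E /E /= scale_block_mx !scaler0 add_block_mx
    !(addr0, add0r).
  rewrite rank_diag_block_mx -(subnKC as_); apply: leq_add; first exact:
    rank_leq_row.
  exact: leq_trans (mxrank_scale _ _) rD.
(* For [0 < t <= 1], [c] bounds both [V + t (W1 + t W2)] and the error [W1 + t W2] in norm. Dividing
   by [c + 1] keeps the denominator positive and gives [t * c < e]. *)
move=> e e0; pose c := `|V| + (`|W1| + `|W2|).
have c0 : 0 <= c by rewrite !addr_ge0.
have c1 : 0 < c + 1 by rewrite ltr_wpDl.
pose t := Num.min 1 (e / (c + 1)).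
have t0 : 0 < t by rewrite lt_min ltr01 divr_gt0.
have t1 : t <= 1 by rewrite ge_min lexx.
have tc : t * c < e.
  have : t <= e / (c + 1) by rewrite ge_min lexx orbT.
  by rewrite ler_pdivlMr // mulrDr mulr1; lra.
have W12 : `|W1 + t *: W2| <= `|W1| + `|W2|.
  apply: le_trans (ler_normD _ _) _; rewrite lerD2l normrZ gtr0_norm //.
  by rewrite ler_piMl.
exists (x t), t^-1; rewrite invr_gt0 xE; split => //.
- rewrite normrZ gtr0_norm //; apply: le_lt_trans tc; rewrite ler_pM2l //.
  apply: le_trans (ler_normD _ _) _; rewrite lerD2l normrZ gtr0_norm //.
  by apply: le_trans W12; rewrite ler_piMl.
- rewrite scalerA mulVf ?gt_eqF // scale1r addrAC subrr add0r normrZ gtr0_norm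
    //.
  by apply: le_lt_trans tc; rewrite ler_pM2l // (le_trans W12) // lerDr.
Qed.

End BlockTangent.

(** * The Euclidean inner product on row vectors *)

Section Dot.
Variables (R : realType) (n : nat).
Implicit Types u v w : 'rV[R]_n.

Definition dot u v : R := (u *m v^T) 0 0.

Lemma dotE u v : dot u v = \sum_i u 0 i * v 0 i.
Proof. by rewrite /dot mxE; apply: eq_bigr => i _; rewrite mxE. Qed.

Lemma mulmx_tr_dot u v : u *m v^T = (dot u v)%:M.
Proof. by rewrite [LHS]mx11_scalar. Qed.

Lemma dotC u v : dot u v = dot v u.
Proof. by rewrite !dotE; apply: eq_bigr => i _; rewrite mulrC. Qed.

Lemma dotDl u v w : dot (u + v) w = dot u w + dot v w.
Proof. by rewrite /dot mulmxDl mxE. Qed.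

Lemma dotZl a u v : dot (a *: u) v = a * dot u v.
Proof. by rewrite /dot -scalemxAl mxE. Qed.

Lemma dotNl u v : dot (- u) v = - dot u v.
Proof. by rewrite /dot mulNmx mxE. Qed.

Lemma dotDr u v w : dot u (v + w) = dot u v + dot u w.
Proof. by rewrite dotC dotDl !(dotC u). Qed.

Lemma dotZr a u v : dot u (a *: v) = a * dot u v.
Proof. by rewrite dotC dotZl dotC. Qed.

Lemma dotNr u v : dot u (- v) = - dot u v.
Proof. by rewrite dotC dotNl dotC. Qed.

Lemma dot_ge0 u : 0 <= dot u u.
Proof. by rewrite dotE; apply: sumr_ge0 => i _; rewrite -expr2 sqr_ge0. Qed.

Lemma dot_eq0 u : dot u u = 0 -> u = 0.
Proof.
rewrite dotE => /psumr_eq0P u0; apply/rowP => i; rewrite mxE; apply/eqP.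
rewrite -sqrf_eq0 expr2; apply/eqP/u0 => // j _.
by rewrite -expr2 sqr_ge0.
Qed.

End Dot.

Lemma dot_mulmx (R : realType) m n (u : 'rV[R]_m) (M : 'M[R]_(m, n)) v :
  dot (u *m M) v = dot u (v *m M^T).
Proof. by rewrite /dot trmx_mul trmxK mulmxA. Qed.

(** * Maximisers of a quadratic form on the unit sphere *)

Section Rayleigh.
Variables (R : realType) (n : nat).

Lemma quadratic_continuous (S : 'M[R]_n) :
  continuous (fun u : 'rV[R]_n => dot (u *m S) u).
Proof.
move=> u; have Fu : Filter (nbhs u) := nbhs_filter u.
rewrite /continuous_at dotE; under eq_cvg do rewrite dotE.
apply: cvg_big => [|i _]; first exact: add_continuous.
apply: cvgM; last exact: coord_continuous.
rewrite mxE; under eq_cvg do rewrite mxE.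
apply: cvg_big => [|j _]; first exact: add_continuous.
by apply: cvgM; [exact: coord_continuous | exact: cvg_cst].
Qed.

Lemma unit_sphere_compact : compact [set u : 'rV[R]_n | dot u u = 1].
Proof.
apply: bounded_closed_compact.
  (* Boundedness refers to the sup norm on row vectors: each coordinate of a unit vector is at most
     1 in absolute value. *)
  exists 1; split => // e e1 u /= u1; apply/ltW; apply: le_lt_trans e1.
  rewrite [leLHS]/Num.norm /= mx_normrE; apply/bigmax_leP; split => // -[i j] _
    /=.
  rewrite (ord1 i) -(@ler_pXn2r _ 2) ?nnegrE // expr1n -u1 dotE.
  rewrite real_normK ?num_real // (bigD1 j) //= -expr2 lerDl.
  by apply: sumr_ge0 => l _; rewrite -expr2 sqr_ge0.
have -> : [set u : 'rV[R]_n | dot u u = 1] =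
    (fun u : 'rV[R]_n => dot (u *m 1%:M) u) @^-1` [set 1].
  by apply/seteqP; split => u /=; rewrite mulmx1.
apply: closed_comp => [u _|]; first exact: quadratic_continuous.
exact: closed_eq.
Qed.

(** The form attains its maximum on the compact sphere; scaling a nonzero [w] to unit length extends
    the bound to all vectors by homogeneity. *)
Lemma Rayleigh_max (S : 'M[R]_n) : (0 < n)%N ->
  exists2 u, dot u u = 1 & forall w, dot (w *m S) w <= dot (u *m S) u * dot w w.
Proof.
move=> n0; pose f (u : 'rV[R]_n) := dot (u *m S) u.
have sphere0 : [set u : 'rV[R]_n | dot u u = 1] !=set0.
  exists (delta_mx 0 (Ordinal n0)); rewrite /= dotE (bigD1 (Ordinal n0)) //=.
  rewrite !mxE !eqxx mulr1 big1 ?addr0 // => i /negPf i0.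
  by rewrite !mxE i0 mul0r.
have [|u] := @EVT_max_rV _ _ f _ sphere0 unit_sphere_compact.
  exact/continuous_subspaceT/quadratic_continuous.
rewrite inE /= => u1 umax; exists u => // w.
have [w0|w0] := eqVneq (dot w w) 0.
  by rewrite w0 (dot_eq0 w0) mul0mx /dot mul0mx mxE mulr0.
have {}w0 : 0 < dot w w by rewrite lt_neqAle eq_sym w0 dot_ge0.
pose c := (Num.sqrt (dot w w))^-1.
have cc : c * c = (dot w w)^-1 by rewrite -expr2 exprVn sqr_sqrtr ?ltW.
have := umax (c *: w); rewrite inE /= /f -scalemxAl !dotZl !dotZr !mulrA cc.
rewrite mulVf ?gt_eqF // => /(_ erefl).
by rewrite mulrC ler_pdivrMr.
Qed.

(** First variation: the form [q] is nonnegative and vanishes at [u]. Along the residual [h] it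
    equals [2 t |h|^2 + t^2 q h], which is negative for small negative [t] unless [h = 0]. *)
Lemma Rayleigh_max_eigen (S : 'M[R]_n) u : S^T = S -> dot u u = 1 ->
  (forall w, dot (w *m S) w <= dot (u *m S) u * dot w w) ->
  u *m S = dot (u *m S) u *: u.
Proof.
move=> trS u1 umax; set l := dot _ _ in umax *.
pose q w := l * dot w w - dot (w *m S) w.
have q0 w : 0 <= q w by rewrite subr_ge0.
have [h hE] : exists h, h = l *: u - u *m S by eexists.
have qE t : q (u + t *: h) = 2 * t * dot h h + t ^+ 2 * q h.
  have uSh : dot (h *m S) u = dot (u *m S) h by rewrite dot_mulmx trS dotC.
  have hh : dot h h = l * dot u h - dot (u *m S) h by rewrite {1}hE dotDl dotZl
    dotNl.
  rewrite /q mulmxDl -scalemxAl !(dotDl, dotDr, dotZl, dotZr) uSh u1 -/l (dotC h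
    u).
  by rewrite hh; lra.
have hh : dot h h = 0.
  (* A near-minimiser in [t] of this quadratic; the [+ 1] covers the case [q h = 0]. *)
  have := q0 (u + (- dot h h / (q h + 1)) *: h); rewrite qE.
  have qh1 : 0 < q h + 1 by rewrite ltr_wpDl.
  have hh0 := dot_ge0 h; move: (dot h h) (q h) (q0 h) hh0 qh1 => p c c0 p0 c1.
  have -> : 2 * (- p / (c + 1)) * p + (- p / (c + 1)) ^+ 2 * c =
     - (p ^+ 2 * (c + 2) / (c + 1) ^+ 2) by field; rewrite gt_eqF.
  rewrite oppr_ge0 pmulr_lle0 ?invr_gt0 ?exprn_gt0 // pmulr_lle0; last by lra.
  by move=> p2; apply/eqP; rewrite -sqrf_eq0 eq_le p2 sqr_ge0.
by apply/esym/eqP; rewrite -subr_eq0 -hE (dot_eq0 hh).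
Qed.

End Rayleigh.

(** The Rayleigh argument is applied to [M *m M^T], which is [- M ^ 2] and whose form is [|w M|^2].
    The eigenvector equation for [u] then reads [u M M = - l^2 u], so [v = u M / l] closes up an
    invariant plane. The final bound, that [l] is the operator norm, later orders the [x i]. *)
Lemma skew_top_pair (R : realType) n (M : 'M[R]_n) : M^T = - M -> M != 0 ->
  exists (u v : 'rV[R]_n) (l : R),
    [/\ 0 < l, [/\ dot u u = 1, dot v v = 1 & dot u v = 0],
        u *m M = l *: v, v *m M = - l *: u &
        forall w, dot (w *m M) (w *m M) <= l ^+ 2 * dot w w].
Proof.
move=> trM M0.
have n0 : (0 < n)%N.
  by case: n M {trM} M0 => // M; rewrite (flatmx0 M) eqxx.
have [u u1 umax] := Rayleigh_max (M *m M^T) n0.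
have fE w : dot (w *m (M *m M^T)) w = dot (w *m M) (w *m M).
  by rewrite mulmxA dot_mulmx trmxK.
have := Rayleigh_max_eigen _ u1 umax; rewrite trmx_mul trmxK => /(_ erefl).
have {}umax w : dot (w *m M) (w *m M) <= dot (u *m M) (u *m M) * dot w w.
  by rewrite -!fE.
rewrite fE mulmxA trM mulmxN.
have [d [dE d0]] : exists d, dot (u *m M) (u *m M) = d /\ 0 <= d.
  by eexists; split; [reflexivity | exact: dot_ge0].
rewrite dE in umax * => uMM.
(* If [d = 0], the bound at the basis vectors makes every row of [M] zero. *)
have {}d0 : 0 < d.
  rewrite lt_neqAle d0 andbT; apply: contraNneq M0 => d_eq0.
  apply/eqP/row_matrixP => i; rewrite row0 rowE; apply: dot_eq0; apply/eqP.
  by rewrite eq_le dot_ge0 andbT; apply: le_trans (umax _) _; rewrite -d_eq0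
    mul0r.
have l0 : 0 < Num.sqrt d by rewrite sqrtr_gt0.
have l2 : Num.sqrt d * Num.sqrt d = d by rewrite -expr2 sqr_sqrtr ?ltW.
move: (Num.sqrt d) l0 l2 => l l0 l2; have ln0 : l != 0 by rewrite gt_eqF.
exists u, (l^-1 *: (u *m M)), l; split => //.
- split=> //; rewrite ?dotZl !dotZr; first by rewrite dE -l2; field.
  (* By skewness [dot (u *m M) u] equals its own opposite. *)
  have := dot_mulmx u M u; rewrite trM mulmxN dotNr dotC => /eqP.
  by rewrite -subr_eq0 opprK -mulr2n mulrn_eq0 /= => /eqP->; rewrite mulr0.
- by rewrite scalerA divff // scale1r.
- rewrite -scalemxAl -[u *m M *m M]opprK uMM scalerN scalerA -l2 mulKf //.
  by rewrite scaleNr.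
- by move=> w; rewrite expr2 l2.
Qed.

(** * Orthogonal matrices with prescribed first rows *)

Definition orthogonal_mx (R : realType) n (Q : 'M[R]_n) := Q *m Q^T = 1%:M.

Section Orthogonal.
Variable R : realType.

Lemma orthogonal_mx1 n : orthogonal_mx (1%:M : 'M[R]_n).
Proof. by rewrite /orthogonal_mx trmx1 mulmx1. Qed.

Lemma orthogonal_mx_tr n (Q : 'M[R]_n) : orthogonal_mx Q -> orthogonal_mx Q^T.
Proof. by rewrite /orthogonal_mx trmxK => /mulmx1C. Qed.

Lemma orthogonal_mx_mul n (P Q : 'M[R]_n) :
  orthogonal_mx P -> orthogonal_mx Q -> orthogonal_mx (P *m Q).
Proof.
rewrite /orthogonal_mx => hP hQ.
by rewrite trmx_mul mulmxA -(mulmxA P) hQ mulmx1.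
Qed.

Lemma orthogonal_mx_block m n (P : 'M[R]_m) (Q : 'M[R]_n) :
  orthogonal_mx P -> orthogonal_mx Q -> orthogonal_mx (block_mx P 0 0 Q).
Proof.
rewrite /orthogonal_mx => hP hQ; rewrite tr_block_mx !trmx0 mulmx_block.
by rewrite !(mul0mx, mulmx0, addr0, add0r) hP hQ -scalar_mx_block.
Qed.

Lemma dot_orthogonal n (Q : 'M[R]_n) u v :
  orthogonal_mx Q -> dot (u *m Q) (v *m Q) = dot u v.
Proof. by move=> hQ; rewrite dot_mulmx -mulmxA hQ mulmx1. Qed.

(* The Householder reflection exchanging e_0 and u. *)
Lemma orthogonal_mx_row0 n (u : 'rV[R]_n.+1) : dot u u = 1 ->
  exists2 Q, orthogonal_mx Q & delta_mx 0 0 *m Q = u.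
Proof.
move=> u1; set e : 'rV[R]_n.+1 := delta_mx 0 0.
have ee : dot e e = 1.
  rewrite dotE (bigD1 0) //= big1 ?addr0 => [|i /negPf i0]; rewrite !mxE ?i0
    ?mulr1 //.
  by rewrite mul0r.
have [w wE] : exists w, w = e - u by eexists.
have [w0|w0] := eqVneq (dot w w) 0.
  exists 1%:M; first exact: orthogonal_mx1.
  by rewrite mulmx1; apply/eqP; rewrite -subr_eq0 -wE (dot_eq0 w0).
(* As [e] and [u] are unit vectors, [b * dot e w = 1], so the reflection sends [e] to
   [e - w = u]. *)
have ew : 2 * dot e w = dot w w.
  rewrite {2}wE dotDl dotNl {2 3}wE !dotDr !dotNr ee u1 (dotC u e).
  by rewrite wE dotDr dotNr ee; lra.
have [b bE] : exists b, b = 2 / dot w w by eexists.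
have trH : (1%:M - b *: (w^T *m w))^T = 1%:M - b *: (w^T *m w).
  by rewrite linearB /= trmx1 linearZ /= trmx_mul trmxK.
exists (1%:M - b *: (w^T *m w)).
  rewrite /orthogonal_mx trH mulmxBr mulmx1 mulmxBl mul1mx.
  rewrite -scalemxAl -!scalemxAr mulmxA -(mulmxA w^T) mulmx_tr_dot.
  rewrite mul_mx_scalar -scalemxAl !scalerA.
  have -> : b * (b * dot w w) = 2 * b by rewrite bE; field.
  move: (_ *m w) => Y; apply/matrixP => i j; rewrite !mxE.
  by lra.
rewrite mulmxBr mulmx1 -scalemxAr mulmxA mulmx_tr_dot mul_scalar_mx scalerA.
have -> : b * dot e w = 1 by rewrite bE -ew; field; move: w0; rewrite -ew
  mulf_eq0 pnatr_eq0.
by rewrite scale1r wE opprB addrC subrK.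
Qed.

(** A first orthogonal matrix [Q1] moves [e_0] to [u]. Since [v] is orthogonal to [u], [v *m Q1^T]
    has zero first coordinate, and a second matrix acting on the other coordinates places it without
    disturbing [e_0]. *)
Lemma orthogonal_mx_row2 n (u v : 'rV[R]_n.+2) :
  dot u u = 1 -> dot v v = 1 -> dot u v = 0 ->
  exists Q, [/\ orthogonal_mx Q, row ord0 Q = u &
                row (lift ord0 ord0) Q = v].
Proof.
move=> u1 v1 uv; have [Q1 hQ1 Q1u] := orthogonal_mx_row0 u1.
have [v' v'E] : exists v' : 'rV[R]_(1 + n.+1), v' = v *m Q1^T by eexists.
have v'0 : lsubmx v' = 0.
  apply/rowP => i; rewrite (ord1 i) [LHS]mxE [RHS]mxE lshift0.
  rewrite -uv -Q1u dotC -{1}[Q1]trmxK -dot_mulmx -v'E dotE (bigD1 0) //= big1.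
    by rewrite !mxE !eqxx mulr1 addr0.
  by move=> j /negPf j0; rewrite !mxE j0 mulr0.
have dv' : dot (rsubmx v') (rsubmx v') = 1.
  rewrite -v1 -(dot_orthogonal v v (orthogonal_mx_tr hQ1)) -v'E.
  rewrite -{3 4}(hsubmxK v') v'0 [RHS]/dot (@tr_row_mx _ 1 1 n.+1) (@mul_row_col
    _ 1 1 n.+1) mul0mx add0r.
  by [].
have [Q2 hQ2 Q2v] := orthogonal_mx_row0 dv'.
exists ((block_mx 1%:M 0 0 Q2 : 'M[R]_(1 + n.+1)) *m Q1); split.
- exact: orthogonal_mx_mul (orthogonal_mx_block (orthogonal_mx1 1) hQ2) hQ1.
- rewrite row_mul (_ : ord0 = lshift n.+1 (ord0 : 'I_1) :> 'I_n.+2); last exact: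
    val_inj.
  rewrite [block_mx _ _ _ _]/(col_mx _ _) (@rowKu _ 1 n.+1 n.+2).
  rewrite -Q1u; congr (_ *m _); apply/rowP => j; rewrite [LHS]mxE [RHS]mxE mxE.
  by case: splitP => j' jE; rewrite mxE -!val_eqE /= jE ?(ord1 j').
- rewrite row_mul (_ : lift ord0 ord0 = rshift 1 ord0); last exact: val_inj.
  rewrite [block_mx _ _ _ _]/(col_mx _ _) (@rowKd _ 1 n.+1 n.+2) (@row_row_mx _
    n.+1 1 n.+1) row0 rowE Q2v.
  by rewrite -v'0 hsubmxK v'E -mulmxA (mulmx1C hQ1) mulmx1.
Qed.

End Orthogonal.

(** * Orthogonal reduction of a skew matrix to normal form *)

Section NormalForm.
Variable R : realType.

Lemma skew_normal_formE n k (x : 'I_k -> R) :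
  mx_of_skew (skew_normal_form n x) =
  \sum_(i < k) x i *: skew_elem_mx R n (2 * i) (2 * i).+1.
Proof. by rewrite /skew_normal_form (big_morph (@mx_of_skew R n) (id1 := 0) (op1
  := +%R)). Qed.

Lemma skew_elem_mx01_block n :
  skew_elem_mx R (2 + n) 0 1 = block_mx (skew_elem_mx R 2 0 1) 0 0 0.
Proof.
apply/matrixP => i j.
case: (split_ordP i) => i' ->; case: (split_ordP j) => j' -> /=;
  rewrite ?block_mxEul ?block_mxEur ?block_mxEdl ?block_mxEdr !mxE //=.
- by rewrite !andbF subrr.
- by rewrite subrr.
- by rewrite subrr.
Qed.

Lemma skew_elem_mx_block n a b :
  skew_elem_mx R (2 + n) a.+2 b.+2 = block_mx 0 0 0 (skew_elem_mx R n a b).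
Proof.
apply/matrixP => i j.
have ltF (i' : 'I_2) c : (i' == c.+2 :> nat) = false by have := ltn_ord i'; lia.
by case: (split_ordP i) => i' ->; case: (split_ordP j) => j' -> /=;
  rewrite ?block_mxEul ?block_mxEur ?block_mxEdl ?block_mxEdr !mxE /= ?ltF
          ?andbF ?subrr.
Qed.

(** Peels off the first plane, which is the induction step on [k] for the normal form. *)
Lemma skew_normal_form_recl n k (x : 'I_k.+1 -> R) :
  mx_of_skew (skew_normal_form (2 + n) x) =
  block_mx (x ord0 *: skew_elem_mx R 2 0 1) 0 0
           (skew_normal_form n (fun i => x (lift ord0 i))).
Proof.
rewrite !skew_normal_formE big_ord_recl muln0 skew_elem_mx01_block.
rewrite scale_block_mx !scaler0.
have -> : \sum_(i < k) x (lift ord0 i) *: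
      skew_elem_mx R (2 + n) (2 * lift ord0 i) (2 * lift ord0 i).+1 =
    block_mx 0 0 0 (\sum_(i < k) x (lift ord0 i) *:
      skew_elem_mx R n (2 * i) (2 * i).+1).
  elim/big_rec2: _ => [|i M N _ ->]; first by rewrite block_mx0.
  rewrite lift0 mulnS skew_elem_mx_block.
  by rewrite scale_block_mx add_block_mx !scaler0 !addr0.
by rewrite add_block_mx !addr0 add0r.
Qed.

Lemma skew_elem_mx01_unit : skew_elem_mx R 2 0 1 \in unitmx.
Proof.
suff /mulmx1_unit[] : skew_elem_mx R 2 0 1 *m (skew_elem_mx R 2 0 1)^T = 1%:M by
  [].
apply/matrixP => i j; rewrite !mxE !big_ord_recl big_ord0 !mxE /=.
by case: i => [[|[|//]] i2]; case: j => [[|[|//]] j2] /=; lra.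
Qed.

(** With [u] and [v] as first rows of [Q], the equations [u M = l v] and [v M = - l u] give the
    first two rows of [Q M Q^T]; skewness then clears the lower-left block. *)
Lemma skew_orthogonal_split n (M : 'M[R]_(2 + n)) : M^T = - M -> M != 0 ->
  exists (Q : 'M[R]_(2 + n)) (l : R) (M' : 'M[R]_n),
  [/\ orthogonal_mx Q, 0 < l, M'^T = - M',
      Q *m M *m Q^T = block_mx (l *: skew_elem_mx R 2 0 1) 0 0 M' &
      (exists2 u, dot u u = 1 & dot (u *m M) (u *m M) = l ^+ 2) /\
      (forall w, dot (w *m M) (w *m M) <= l ^+ 2 * dot w w)].
Proof.
move=> trM M0; have [u [v [l [l0 [u1 v1 uv] uM vM lmax]]]] := skew_top_pair trM
  M0.
have [Q [hQ Qu Qv]] := orthogonal_mx_row2 u1 v1 uv.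
have [M2 M2E] : exists M2 : 'M[R]_(2 + n), M2 = Q *m M *m Q^T by eexists.
have trM2 : M2^T = - M2.
  by rewrite M2E !trmx_mul trmxK trM mulNmx mulmxN mulmxA.
have skM2 i j : M2 i j = - M2 j i.
  by have /matrixP/(_ j i) := trM2; rewrite !mxE.
have r0 j : M2 ord0 j = l * (j == lift ord0 ord0)%:R.
  have -> : M2 ord0 j = row ord0 M2 0 j by rewrite mxE.
  rewrite M2E !row_mul Qu uM -Qv rowE -!scalemxAl -mulmxA hQ mulmx1.
  by rewrite !mxE.
have r1 j : M2 (lift ord0 ord0) j = - l * (j == ord0)%:R.
  have -> : M2 (lift ord0 ord0) j = row (lift ord0 ord0) M2 0 j by rewrite mxE.
  rewrite M2E !row_mul Qv vM -Qu rowE -!scalemxAl -mulmxA hQ mulmx1.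
  by rewrite !mxE.
exists Q, l, (drsubmx M2); split => //.
- by rewrite trmx_drsub trM2; apply/matrixP => i j; rewrite !mxE.
- rewrite -M2E -[LHS]submxK.
  have upE (i : 'I_2) (j : 'I_(2 + n)) : M2 (lshift n i) j =
      l * (((i == 0 :> nat) && (j == 1 :> nat))%:R - ((i == 1 :> nat) && (j == 0
        :> nat))%:R).
    case: i => [[|[|//]] i2] /=; rewrite ?subr0 ?sub0r.
      rewrite (_ : @lshift 2 n _ = ord0); last exact: val_inj.
      by rewrite r0.
    rewrite (_ : @lshift 2 n _ = lift ord0 ord0); last exact: val_inj.
    by rewrite r1 mulrN mulNr.
  congr (@block_mx _ 2 n 2 n); apply/matrixP => i j; rewrite !mxE.
  + by rewrite upE.
  + by rewrite upE !andbF subrr mulr0.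
  + by rewrite skM2 upE !andbF subrr mulr0 oppr0.
- by split=> //; exists u => //; rewrite uM dotZl dotZr v1 mulr1.
Qed.

(** Induction on [k], splitting off one plane at a time. The last clause, that every operator bound
    on [M] bounds all [x i], strengthens the induction so that the new top value [l] dominates the
    remaining ones. *)
Lemma skew_normal_form_orthogonal k n (M : 'M[R]_n) :
  M^T = - M -> \rank M = (2 * k)%N ->
  exists (Q : 'M[R]_n) (x : 'I_k -> R),
  [/\ orthogonal_mx Q, forall i j : 'I_k, (i <= j)%N -> x j <= x i,
      forall i, 0 < x i,
      Q *m M *m Q^T = skew_normal_form n x &
      forall c, 0 <= c ->
        (forall u, dot (u *m M) (u *m M) <= c ^+ 2 * dot u u) ->
        forall i, x i <= c].
Proof.
elim: k n M => [|k IH] n M trM rM.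
  have M0 : M = 0 by apply/eqP; rewrite -mxrank_eq0 rM.
  exists 1%:M, (fun=> 0); split=> [||||c c0 _]; [exact: orthogonal_mx1 | by case
    | by case | | by case].
  by rewrite skew_normal_formE big_ord0 M0 mulmx0 mul0mx.
have M0 : M != 0 by rewrite -mxrank_eq0 rM.
have n2 : (2 <= n)%N by have := rank_leq_row M; rewrite rM; lia.
have [n' nE] : exists n', n = (2 + n')%N by exists (n - 2)%N; lia.
subst n => {n2}; rename n' into n.
have [Q [l [M' [hQ l0 trM' QM [[u u1 lE] lmax]]]]] := skew_orthogonal_split trM
  M0.
have rM' : \rank M' = (2 * k)%N.
  have : \rank (Q *m M *m Q^T) = (2 * k.+1)%N.
    have Qu : Q \in unitmx by have [] := mulmx1_unit hQ.
    rewrite mxrankMfree ?row_free_unit ?unitmx_tr // -mxrank_tr trmx_mul.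
    by rewrite mxrankMfree ?mxrank_tr // row_free_unit unitmx_tr.
  rewrite QM rank_diag_block_mx mxrank_scale_nz ?gt_eqF //.
  by rewrite (eqP (_ : row_free _)) ?row_free_unit ?skew_elem_mx01_unit //; lia.
have [Q' [x [hQ' xmono x0 xE xmax]]] := IH _ _ trM' rM'.
(* [M'] is the action of [M] on the vectors [(0, w) Q], and [Q] preserves lengths. *)
have M'le c : (forall u, dot (u *m M) (u *m M) <= c ^+ 2 * dot u u) ->
    forall u, dot (u *m M') (u *m M') <= c ^+ 2 * dot u u.
  move=> Mle w; have dot0 (a b : 'rV[R]_n) :
      dot (row_mx (0 : 'rV_2) a) (row_mx 0 b) = dot a b.
    by rewrite /dot tr_row_mx mul_row_col mul0mx add0r.
  have := Mle (row_mx (0 : 'rV_2) w *m Q); rewrite (dot_orthogonal _ _ hQ) dot0.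
  rewrite -(dot_orthogonal _ _ (orthogonal_mx_tr hQ)) -!(mulmxA (row_mx _ _)).
  rewrite QM mul_row_block !(mul0mx, mulmx0, add0r, addr0).
  by rewrite dot0.
have xl : forall i, x i <= l by apply: xmax; [exact: ltW | exact: M'le].
pose y i := if unlift ord0 i is Some j then x j else l.
have y0 : y ord0 = l by rewrite /y unlift_none.
have yS i : y (lift ord0 i) = x i by rewrite /y liftK.
exists (block_mx 1%:M 0 0 Q' *m Q), y; split.
- apply: orthogonal_mx_mul hQ; apply: orthogonal_mx_block hQ'.
  exact: orthogonal_mx1.
- move=> i j; case: (unliftP ord0 i) => [i'|] ->; case: (unliftP ord0 j) =>
    [j'|] -> //.
  + by rewrite !yS !lift0 => /xmono.
  + by rewrite y0 yS => _; apply: xl.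
- by move=> i; case: (unliftP ord0 i) => [i'|] ->; rewrite ?yS ?y0.
- rewrite skew_normal_form_recl y0.
  have -> : (fun i => y (lift ord0 i)) = x by apply/funext.
  rewrite trmx_mul -!mulmxA (mulmxA Q) (mulmxA (Q *m M)) QM -xE.
  rewrite tr_block_mx !trmx0 trmx1 !mulmx_block.
  by rewrite !(mul0mx, mulmx0, add0r, addr0, mul1mx, mulmx1) mulmxA.
- move=> c c0 Mle i; case: (unliftP ord0 i) => [i'|] ->; rewrite ?yS ?y0.
    exact: xmax c0 (M'le _ Mle) i'.
  rewrite -(@ler_pXn2r _ 2) ?nnegrE ?(ltW l0) // -lE.
  by apply: le_trans (Mle u) _; rewrite u1 mulr1.
Qed.

End NormalForm.

(** * Invariance of norm, rank bound and tangent cone under orthogonal conjugation *)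

Section SkewConj.
Variables (R : realType) (n : nat).
Implicit Types (P : 'M[R]_n) (M N V : 'Skew[R]_n).

Lemma skew_conjB P M N : skew_conj P (M - N) = skew_conj P M - skew_conj P N.
Proof. by apply: mx_of_skew_inj; rewrite skewmxB /= mulmxBr mulmxBl. Qed.

Lemma skew_conjZ P c M : skew_conj P (c *: M) = c *: skew_conj P M.
Proof. by apply: mx_of_skew_inj; rewrite skewmxZ /= -scalemxAr -scalemxAl. Qed.

Lemma norm_skew_conj P M : orthogonal_mx P -> `|skew_conj P M| = `|M|.
Proof.
move=> /mulmx1C hP; rewrite !norm_skewmxE /skew_norm /= !trmx_mul trmxK.
by rewrite !mulmxA -(mulmxA _ P^T P) hP mulmx1 -!mulmxA mxtrace_mulC -!mulmxA hP
  mulmx1.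
Qed.

Lemma skew_conjK P M : orthogonal_mx P -> skew_conj P^T (skew_conj P M) = M.
Proof.
move=> /mulmx1C hP; apply: mx_of_skew_inj.
by rewrite /= trmxK !mulmxA hP mul1mx -mulmxA hP mulmx1.
Qed.

Lemma skew_conjVK P M : orthogonal_mx P -> skew_conj P (skew_conj P^T M) = M.
Proof. by move=> hP; rewrite -{1}[P]trmxK skew_conjK //; exact:
  orthogonal_mx_tr. Qed.

Lemma rank_skew_conj_le P M : (\rank (skew_conj P M) <= \rank M)%N.
Proof. exact: leq_trans (mxrankM_maxl _ _) (mxrankM_maxr _ _). Qed.

Lemma Tan_skew_conj_sub P s M V : orthogonal_mx P ->
  Tan (pfaffian_variety n s) M V ->
  Tan (pfaffian_variety n s) (skew_conj P M) (skew_conj P V).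
Proof.
move=> hP tV e /tV[x [rho [xs rho0 xM xV]]]; exists (skew_conj P x), rho.
split=> //; first exact: leq_trans (rank_skew_conj_le _ _) xs.
  by rewrite -skew_conjB norm_skew_conj.
by rewrite -skew_conjB -skew_conjZ -skew_conjB norm_skew_conj.
Qed.

Lemma Tan_skew_conj P s M V : orthogonal_mx P ->
  Tan (pfaffian_variety n s) (skew_conj P M) (skew_conj P V) <->
  Tan (pfaffian_variety n s) M V.
Proof.
move=> hP; split; last exact: Tan_skew_conj_sub.
move/(Tan_skew_conj_sub (orthogonal_mx_tr hP)).
by rewrite !skew_conjK.
Qed.

End SkewConj.

(** * Passage from orthogonal matrices to [SO] *)

Section NormalFormSO.
Variables (R : realType) (n k : nat).

Lemma skew_normal_form_eq0 (x : 'I_k -> R) (i j : 'I_n) :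
  (2 * k <= i)%N || (2 * k <= j)%N ->
  (skew_normal_form n x : 'M[R]_n) i j = 0.
Proof.
move=> kij; rewrite skew_normal_formE summxE big1 // => l _; rewrite !mxE.
have lk := ltn_ord l.
have -> : (i == (2 * l)%N :> nat) && (j == (2 * l).+1 :> nat) = false by lia.
have -> : (i == (2 * l).+1 :> nat) && (j == (2 * l)%N :> nat) = false by lia.
by rewrite subrr mulr0.
Qed.

Lemma skew_normal_form_SO (M : 'Skew[R]_n) :
  (2 * k < n)%N -> \rank M = (2 * k)%N ->
  exists (P : 'M[R]_n) (x : 'I_k -> R),
  [/\ SO n P, forall i j : 'I_k, (i <= j)%N -> x j <= x i,
      forall i, 0 < x i & skew_conj P M = skew_normal_form n x].
Proof.
move=> kn rM.
have [Q [x [hQ xmono x0 QE _]]] := skew_normal_form_orthogonal (tr_skewmx M) rM.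
have : \det Q ^+ 2 = 1 by rewrite expr2 -{2}det_tr -det_mulmx hQ det1.
move/eqP; rewrite sqrf_eq1 => /orP[] /eqP dQ.
  by exists Q, x; split => //; apply: mx_of_skew_inj.
(* Counting from 0, [2 * k] is the first index whose row and column vanish in the normal form, so a
   sign change there leaves it fixed. *)
pose i0 : 'I_n := Ordinal kn.
pose f : 'rV[R]_n := \row_j (if j == i0 then -1 else 1).
have dF : \det (diag_mx f) = -1.
  rewrite det_diag (bigD1 i0) //= big1 => [|j /negPf j0]; rewrite mxE ?eqxx
    ?mulr1 //.
  by rewrite j0.
have hF : orthogonal_mx (diag_mx f).
  rewrite /orthogonal_mx tr_diag_mx mul_diag_mx; apply/matrixP => i j; rewrite
    !mxE.
  case: (i == i0); case: (i == j); rewrite ?mulr0n ?mulr1n; lra.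
exists (diag_mx f *m Q), x; split => //.
  by split; [exact: orthogonal_mx_mul | rewrite det_mulmx dF dQ mulrNN mulr1].
apply: mx_of_skew_inj; rewrite /= trmx_mul -!mulmxA (mulmxA Q) (mulmxA (Q *m
  M)).
rewrite QE tr_diag_mx mul_mx_diag mul_diag_mx; apply/matrixP => i j; rewrite
  !mxE.
case: (eqVneq i i0) => [->|_]; first by rewrite skew_normal_form_eq0 /= ?leqnn
  // !(mulr0, mul0r).
case: (eqVneq j i0) => [->|_]; first by rewrite skew_normal_form_eq0 /= ?leqnn
  ?orbT // !(mulr0, mul0r).
by rewrite mul1r mulr1.
Qed.

End NormalFormSO.

(** * Coordinates above the diagonal *)

Section UpperCoordinates.
Variable R : realType.

Lemma sqr_norm_skewmx_upper n (W : 'Skew[R]_n) :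
  `|W| ^+ 2 = \sum_(i < n) \sum_(j < n) (if (i < j)%N then (W : 'M[R]_n) i j ^+
    2 else 0).
Proof.
rewrite sqr_norm_skewmx; set S := RHS.
have skW i j : (W : 'M[R]_n) i j = - (W : 'M[R]_n) j i.
  by have /matrixP/(_ j i) := tr_skewmx W; rewrite !mxE.
suff -> : \sum_i \sum_j (W : 'M[R]_n) i j ^+ 2 = S + S by lra.
rewrite {2}/S [X in _ = S + X]exchange_big /= -big_split; apply: eq_bigr => i _
  /=.
rewrite -big_split; apply: eq_bigr => j _ /=.
case: ltngtP => [_|_|/val_inj <-]; rewrite ?addr0 ?add0r //.
  by rewrite skW sqrrN.
have := skW i i; move: (mx_of_skew W i i) => w ww; have -> : w = 0 by lra.
by rewrite expr0n.
Qed.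

Definition upper_pairs a m : {set 'I_(a + m) * 'I_(a + m)} :=
  [set p : 'I_(a + m) * 'I_(a + m) | (p.1 < p.2)%N && (p.1 < a)%N].

(** Row [i] holds [a + m - i.+1] pairs. The count is doubled to avoid a division; at [a = 2 * k] it
    yields the dimension [k * (2 * n - 2 * k - 1)] with [n = a + m]. *)
Lemma card_upper_pairs a m :
  (2 * #|upper_pairs a m| = a * (2 * (a + m) - a - 1))%N.
Proof.
have inner N i : (\sum_(j < N) (i < j : nat) = N - i.+1)%N.
  elim: N => [|N IH]; first by rewrite big_ord0.
  by rewrite big_ord_recr /= IH; case: ltnP; lia.
have outer N b : (b <= N)%N ->
    (2 * (\sum_(i < b) (N - i.+1)) = b * (2 * N - b - 1))%N.
  elim: b => [|b IH] bN; first by rewrite big_ord0.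
  rewrite big_ord_recr /= mulnDr IH; last lia.
  have [c ->] : exists c, N = (b + c.+1)%N by exists (N - b.+1)%N; lia.
  have -> : (2 * (b + c.+1) - b - 1 = b + 2 * c + 1)%N by lia.
  have -> : (2 * (b + c.+1) - b.+1 - 1 = b + 2 * c)%N by lia.
  have -> : (b + c.+1 - b.+1 = c)%N by lia.
  by rewrite mulSn mulnDr muln1; lia.
rewrite -outer ?leq_addr //; congr (2 * _)%N.
rewrite -sum1_card (eq_bigl (fun p : 'I_(a + m) * 'I_(a + m) => (p.1 < p.2)%N &&
  (p.1 < a)%N)); last first.
  by move=> p; rewrite inE.
rewrite big_mkcond -(pair_bigA _ (fun i j : 'I_(a + m) => if (i < j)%N && (i <
  a)%N then 1 else 0)%N) /=.
rewrite big_split_ord /= [X in (_ + X)%N]big1 ?addn0 => [|i _].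
  apply: eq_bigr => i _; rewrite -inner; apply: eq_bigr => j _.
  by rewrite ltn_ord andbT; case: ltnP.
by rewrite big1 // => j _; rewrite [(_ < a)%N]ltnNge leq_addr andbF.
Qed.

Lemma drsubmx_skew_subproof a m (W : 'Skew[R]_(a + m)) :
  drsubmx (W : 'M[R]_(a + m)) \in @Defs.is_skew R m.
Proof.
by rewrite unfold_in trmx_drsub tr_skewmx; apply/eqP/matrixP => i j; rewrite
  !mxE.
Qed.

Definition drsubmx_skew a m (W : 'Skew[R]_(a + m)) : 'Skew[R]_m :=
  Skewmx (drsubmx_skew_subproof W).

Lemma drsubmx_skewB a m (V W : 'Skew[R]_(a + m)) :
  drsubmx_skew (V - W) = drsubmx_skew V - drsubmx_skew W.
Proof. by apply: mx_of_skew_inj; apply/matrixP => i j; rewrite !mxE. Qed.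

(** In the sum over entries above the diagonal, the first [a] rows give the pairs and the last [m]
    rows give the lower-right block, since their first [a] columns lie below the diagonal. *)
Lemma sqr_norm_skewmx_split a m (W : 'Skew[R]_(a + m)) :
  `|W| ^+ 2 = `|drsubmx_skew W| ^+ 2 +
    \sum_(l < #|upper_pairs a m|)
      (W : 'M[R]_(a + m)) (enum_val l).1 (enum_val l).2 ^+ 2.
Proof.
rewrite -(big_enum_val (fun p : 'I_(a + m) * 'I_(a + m) => (W : 'M[R]_(a + m))
  p.1 p.2 ^+ 2)).
rewrite big_mkcond /= [X in _ + X](eq_bigr (fun p : 'I_(a + m) * 'I_(a + m) =>
  if (p.1 < p.2)%N && (p.1 < a)%N then (W : 'M[R]_(a + m)) p.1 p.2 ^+ 2 else
    0)); last first.
  by move=> p _; rewrite inE.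
rewrite -(pair_bigA _ (fun i j : 'I_(a + m) =>
  if (i < j)%N && (i < a)%N then (W : 'M[R]_(a + m)) i j ^+ 2 else 0)) /=.
rewrite !sqr_norm_skewmx_upper !big_split_ord /=.
rewrite [X in _ = _ + (_ + X)]big1 ?addr0 => [|i _]; last first.
  by rewrite big1 // => j _; rewrite [(_ < a)%N]ltnNge leq_addr andbF.
rewrite addrC; congr (_ + _); apply: eq_bigr => i _; last first.
  by apply: eq_bigr => j _; rewrite ltn_ord andbT.
rewrite big_split_ord /= big1 ?add0r => [|j _].
  by apply: eq_bigr => j _; rewrite ltn_add2l !mxE.
by rewrite ltnNge ltnW // ltn_addr.
Qed.

(** Surjectivity of the coordinate map: [U] carries [q] on the chosen pairs, and
    [U - U^T + diag(0, D)] is the matrix sought, its three supports being disjoint. *)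
Lemma skewmx_of_coords a m (q : 'rV[R]_#|upper_pairs a m|) (D : 'Skew[R]_m) :
  exists W : 'Skew[R]_(a + m), drsubmx_skew W = D /\
    forall l, (W : 'M[R]_(a + m)) (enum_val l).1 (enum_val l).2 = q 0 l.
Proof.
pose U : 'M[R]_(a + m) := \matrix_(i, j) \sum_l (enum_val l == (i, j))%:R * q 0
  l.
have U0 i j : (i, j) \notin upper_pairs a m -> U i j = 0.
  move=> ij; rewrite mxE big1 // => l _; case: eqP => [lij|_]; last by rewrite
    mul0r.
  by move: ij; rewrite -lij enum_valP.
have UE l : U (enum_val l).1 (enum_val l).2 = q 0 l.
  rewrite mxE -surjective_pairing (bigD1 l) //= eqxx mul1r big1 ?addr0 // => h
    /negPf hl.
  by rewrite (inj_eq enum_val_inj) hl mul0r.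
move: U U0 UE => U U0 UE.
have trD : (block_mx 0 0 0 (D : 'M[R]_m))^T = - block_mx (0 : 'M_a) 0 0 (D :
  'M[R]_m).
  by rewrite tr_block_mx !trmx0 tr_skewmx opp_block_mx !oppr0.
have W_skew : U - U^T + block_mx 0 0 0 (D : 'M[R]_m) \in @Defs.is_skew R (a +
  m).
  rewrite unfold_in; apply/eqP; move: (block_mx _ _ _ _) trD => M trM.
  apply/matrixP => i j; have /matrixP/(_ i j) := trM; rewrite !mxE => ->.
  by rewrite opprD opprB.
have WE N i j : (U - U^T + N) i j = U i j - U j i + N i j by rewrite !mxE.
exists (Skewmx W_skew); split => [|l].
  apply: mx_of_skew_inj; apply/matrixP => i j.
  have ra (h : 'I_m) : (rshift a h < a)%N = false by rewrite ltnNge /= leq_addr.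
  rewrite [LHS]mxE [LHS]mxE WE block_mxEdr.
  by rewrite !U0 ?inE ?ra ?andbF // subrr add0r.
have := UE l; have := enum_valP l; move: (enum_val l) => [i j]; rewrite inE /=.
case/andP => ij ia <-; rewrite WE (U0 j i).
  rewrite subr0 (_ : block_mx _ _ _ _ i j = 0) ?addr0 //.
  have -> : i = lshift m (Ordinal ia) by exact: val_inj.
  by case: (split_ordP j) => j' ->; rewrite ?block_mxEul ?block_mxEur mxE.
by rewrite inE /= ltnNge (ltnW ij).
Qed.

End UpperCoordinates.

(** * The tangent cone as a product, for block matrices *)

Section IsometryBlock.
Variables (R : realType) (a m s : nat).
Variables (A0 : 'M[R]_a) (M0 : 'Skew[R]_(a + m)).
Hypotheses (A0_unit : A0 \in unitmx) (leas : (a <= s)%N).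
Hypothesis M0E : (M0 : 'M[R]_(a + m)) = block_mx A0 0 0 0.

Lemma Tan_drsubmx (V : 'Skew[R]_(a + m)) :
  Tan (pfaffian_variety (a + m) s) M0 V <->
  (\rank (drsubmx (V : 'M[R]_(a + m))) <= s - a)%N.
Proof.
have VE : (V : 'M[R]_(a + m)) =
    block_mx (ulsubmx (V : 'M[R]_(a + m))) (ursubmx (V : 'M[R]_(a + m)))
      (- (ursubmx (V : 'M[R]_(a + m)))^T) (drsubmx (V : 'M[R]_(a + m))).
  rewrite -[LHS]submxK; congr block_mx; rewrite trmx_ursub tr_skewmx.
  by apply/matrixP => i j; rewrite !mxE opprK.
split; first exact: Tan_rank_drsubmx A0_unit M0E VE.
exact: rank_drsubmx_Tan A0_unit M0E VE leas.
Qed.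

Lemma Tan_isometric d (P : 'M[R]_(a + m)) (M : 'Skew[R]_(a + m)) :
  #|upper_pairs a m| = d -> orthogonal_mx P -> skew_conj P M = M0 ->
  isometric (fun U V : 'Skew[R]_(a + m) => `|U - V|)
    (Tan (pfaffian_variety (a + m) s) M)
    (@prod_dist R m d)
    (pfaffian_variety m (s - a) `*` [set: 'rV[R]_d]).
Proof.
move=> <- hP PM.
have TanE V : Tan (pfaffian_variety (a + m) s) M V <->
    (\rank (drsubmx (skew_conj P V : 'M[R]_(a + m))) <= s - a)%N.
  by rewrite -(Tan_skew_conj s M V hP) PM; exact: Tan_drsubmx.
pose f (V : 'Skew[R]_(a + m)) := (drsubmx_skew (skew_conj P V),
  \row_l (skew_conj P V : 'M[R]_(a + m)) (enum_val l).1 (enum_val (A :=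
    upper_pairs a m) l).2).
(* Distances are preserved on the whole space, so injectivity is automatic and only the image of the
   cone remains to be identified. *)
have f_dist U V : prod_dist (f U) (f V) = `|U - V|.
  have l2 (I : finType) (g : I -> R) : l2norm g ^+ 2 = \sum_i g i ^+ 2.
    by rewrite /l2norm sqr_sqrtr ?sumsq_ge0.
  rewrite /prod_dist /f /= l2 -drsubmx_skewB -skew_conjB.
  rewrite -(norm_skew_conj (U - V) hP) -[RHS]normr_id -sqrtr_sqr.
  congr Num.sqrt; rewrite sqr_norm_skewmx_split; congr (_ + _).
  by apply: eq_bigr => l _; rewrite skew_conjB !mxE.
exists f; split => //; split.
- by move=> V /TanE rV; split.
- move=> U V _ _ fUV; apply/eqP; rewrite -subr_eq0 -normr_eq0 -f_dist fUV
    f_dist.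
  by rewrite subrr normr0.
- move=> [D q] /= [rD _]; have [W [WD Wq]] := skewmx_of_coords q D.
  exists (skew_conj P^T W).
    by apply/TanE; rewrite skew_conjVK // -[drsubmx _]/(mx_of_skew (drsubmx_skew
      W)) WD.
  rewrite /f skew_conjVK // WD; congr pair.
  by apply/rowP => l; rewrite mxE Wq.
Qed.

End IsometryBlock.

(** * Specialisation to the normal form *)

Section NormalFormTangent.
Variables (R : realType) (k : nat).

(** The matrix is zero outside its upper-left block, which therefore has the full rank [2 * k] and
    is invertible. *)
Lemma skew_normal_form_block m (x : 'I_k -> R) :
  \rank (skew_normal_form (2 * k + m) x) = (2 * k)%N ->
  exists2 A0 : 'M[R]_(2 * k), A0 \in unitmx &
    mx_of_skew (skew_normal_form (2 * k + m) x) = block_mx A0 0 0 0.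
Proof.
set N := mx_of_skew _ => rN; exists (ulsubmx N).
  have NE : N = block_mx (ulsubmx N) 0 0 0.
    rewrite -[LHS]submxK; congr block_mx; apply/matrixP => i j;
      rewrite !mxE skew_normal_form_eq0 //= ?leq_addr ?orbT //.
  rewrite -row_free_unit /row_free -[X in _ == X]rN [in X in _ == X]NE.
  by rewrite rank_diag_block_mx mxrank0 addn0.
rewrite -[LHS]submxK; congr block_mx; apply/matrixP => i j;
  rewrite !mxE skew_normal_form_eq0 //= ?leq_addr ?orbT //.
Qed.

Lemma Tan_skew_normal_form m n s (e : (2 * k + m)%N = n) (x : 'I_k -> R)
    (V : 'Skew[R]_n) A B D :
  (2 * k <= s)%N -> \rank (skew_normal_form n x) = (2 * k)%N ->
  (V : 'M[R]_n) = castmx (e, e) (block_mx A B (- B^T) D) ->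
  Tan (pfaffian_variety n s) (skew_normal_form n x) V <->
  (\rank D <= s - 2 * k)%N.
Proof.
(* Eliminating [e] substitutes [2 * k + m] for [n], which makes the cast trivial. *)
move=> ks; case: n / e V => V /skew_normal_form_block[A0 A0u NE].
rewrite castmx_id => VE; rewrite (Tan_drsubmx A0u ks NE) VE.
by rewrite block_mxKdr.
Qed.

Lemma Tan_pfaffian_isometric m n s d (e : (2 * k + m)%N = n) (M : 'Skew[R]_n) :
  (2 * k <= s)%N -> (2 * k < n)%N -> \rank M = (2 * k)%N ->
  d = (k * (2 * n - 2 * k - 1))%N ->
  isometric (fun U V : 'Skew[R]_n => `|U - V|)
    (Tan (pfaffian_variety n s) M)
    (@prod_dist R m d)
    (pfaffian_variety m (s - 2 * k) `*` [set: 'rV[R]_d]).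
Proof.
move=> ks; case: n / e M => M kn rM ->.
have [P [x [[hP _] _ _ PM]]] := skew_normal_form_SO kn rM.
(* Conjugation by [P] and then by [P^T] bounds each rank by the other. *)
have rN : \rank (skew_normal_form (2 * k + m) x) = (2 * k)%N.
  rewrite -PM -[RHS]rM; apply/eqP; rewrite eqn_leq rank_skew_conj_le.
  by rewrite -{1}(skew_conjK M hP) rank_skew_conj_le.
have [A0 A0u NE] := skew_normal_form_block rN.
apply: (Tan_isometric A0u ks NE _ hP PM).
have := card_upper_pairs (2 * k) m; move: #|_| => c.
by rewrite -mulnA => /eqP; rewrite eqn_pmul2l // => /eqP->.
Qed.

End NormalFormTangent.

Theorem theorem7p2 (R : realType) (n r k : nat)
    (hr : (r < n./2)%N) (hk : (k <= r)%N)
    (M0 : 'Skew[R]_n) (hM0 : \rank (M0 : 'M[R]_n) = (2 * k)%N) :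
  [/\ (forall P : 'M[R]_n, SO n P -> forall M N : 'Skew[R]_n,
         `|skew_conj P M - skew_conj P N| = `|M - N|),
      (exists P : 'M[R]_n, exists x : 'I_k -> R,
         [/\ SO n P,
             (forall i j : 'I_k, (i <= j)%N -> x j <= x i),
             (forall i : 'I_k, 0 < x i) &
             skew_conj P M0 = skew_normal_form n x]),
      (forall x : 'I_k -> R,
         (forall i j : 'I_k, (i <= j)%N -> x j <= x i) ->
         (forall i : 'I_k, 0 < x i) ->
         M0 = skew_normal_form n x ->
         forall (V : 'Skew[R]_n) (A : 'M[R]_(2 * k))
                (B : 'M[R]_(2 * k, n - 2 * k)) (D : 'M[R]_(n - 2 * k)),
           (V : 'M[R]_n) = castmx (block_dim hr hk, block_dim hr hk)
                             (block_mx A B (- B^T) D) ->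
           (Tan (pfaffian_variety n (2 * r)) M0 V
              <-> (\rank D <= 2 * r - 2 * k)%N)) &
      isometric
        (fun U V : 'Skew[R]_n => `|U - V|)
        (Tan (pfaffian_variety n (2 * r)) M0)
        (@prod_dist R (n - 2 * k) (k * (2 * n - 2 * k - 1)))
        (pfaffian_variety (n - 2 * k) (2 * r - 2 * k) `*`
           [set: 'rV[R]_(k * (2 * n - 2 * k - 1))])].

Proof.
have k2s : (2 * k <= 2 * r)%N by lia.
(* The strict inequality leaves a kernel index for the determinant correction. *)
have k2n : (2 * k < n)%N by lia.
split.
- by move=> P [hP _] M N; rewrite -skew_conjB norm_skew_conj.
- exact: skew_normal_form_SO.
- move=> x _ _ M0E V A B D VE; rewrite M0E.
  by apply: Tan_skew_normal_form VE; rewrite -?M0E.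
- by have := Tan_pfaffian_isometric (block_dim hr hk) k2s k2n hM0 erefl.
Qed.
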